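(* Let $n,m$ be positive integers, let $p,q\in\mathbb{C}$, and let $f:\mathbb{R}\to\mathbb{C}$ be a measurable function satisfying $$\sum_{k\in\mathbb{Z}} f(x-kn)=p,\qquad \sum_{k\in\mathbb{Z}} f(x-km)=q\qquad\text{for a.e. } x\in\mathbb{R},$$ where both series converge absolutely for a.e. $x$. Then the vector $(p,q)$ must be proportional to $(m,n)$.
   Context: A vector $u\in\mathbb{C}^2$ is said to be proportional to a vector $v$ if $u=\lambda v$ for some scalar $\lambda\in\mathbb{C}$. The function $f$ is assumed neither nonnegative nor integrable. *)

(* Defs.v *)
From HB Require Import structures.
From mathcomp Require Import all_boot all_order all_algebra.
From mathcomp Require Import all_classical all_reals all_analysis.
From mathcomp Require Export complex.

Set Implicit Arguments.
Unset Strict Implicit.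
Unset Printing Implicit Defensive.
Import Order.TTheory GRing.Theory Num.Theory.
Import numFieldNormedType.Exports.

Local Open Scope classical_set_scope.
Local Open Scope ring_scope.

(* The real line with the sigma-algebra of Lebesgue measurable sets, i.e. the
   domain of completed_lebesgue_measure. *)
Definition lebesgueType (R : realType) :=
  caratheodory_type (@wlength R idfun)^*%mu.

(* R[i]^o is the complex field with the topology of its own norm. *)
Definition borelC (R : realType) := g_sigma_algebraType (@open R[i]^o).

Definition lebesgue_measurableC (R : realType) (f : R -> R[i]) : Prop :=
  measurable_fun [set: lebesgueType R] (f : lebesgueType R -> borelC R).

(* Normc.normc is the R-valued modulus; `|z| would be R[i]-valued. *)
Definition zseries_abs_cvg (R : realType) (u : int -> R[i]) : Prop :=
  summable [set: int] (fun k => (Normc.normc (u k))%:E).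

(* As Negz k = - k.+1, the N-th term of this sequence is the sum of u over
   - N <= k < N. It is only used together with zseries_abs_cvg, in which case
   the order of summation is immaterial. *)
Definition zseries_cvg (R : realType) (u : int -> R[i]) (s : R[i]) : Prop :=
  series (fun k : nat => (u (Posz k) + u (Negz k) : R[i]^o)) @ \oo
    --> (s : R[i]^o).

Definition proportional (R : realType) (u v : R[i]^o * R[i]^o) : Prop :=
  exists lambda : R[i], u = lambda *: v.

(* Main.v *)
(* By translation invariance, for almost every x both series converge at x - i
   for every natural number i.  Adding the partial sums over -N <= k < N of the
   first series at x, x - 1, ..., x - (n - 1) gives the sum of f (x - j) over
   -N n <= j < N n, which therefore tends to n p.  Likewise the sum over
   -N m <= j < N m tends to m q.  Both sequences contain the sums over
   -N n m <= j < N n m, hence n p = m q. *)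
Require Import Defs.
From mathcomp Require Import all_boot all_order all_algebra.
From mathcomp Require Import all_classical all_reals all_analysis.
From mathcomp Require Import measurable_realfun.
From mathcomp Require Import zify.
Import Order.TTheory GRing.Theory Num.Theory.
Import numFieldNormedType.Exports.
Local Open Scope classical_set_scope.
Local Open Scope ring_scope.

Lemma measurable_shift (R : realType) (a : R) :
  measurable_fun [set: measurableTypeR R]
    ((fun x => x + a) : measurableTypeR R -> measurableTypeR R).
Proof. exact: measurable_funD. Qed.

(** Uniqueness of Lebesgue measure: its pushforward under a translation still gives every half-open
    interval its length. *)
Lemma lebesgue_measure_shift (R : realType) (a : R) (A : set R) :
  measurable A ->
  lebesgue_measure ((fun x : R => x + a) @^-1` A) = lebesgue_measure A.
Proof.
move=> mA.
have shiftE X : lebesgue_measure ((fun x : R => x + a) @^-1` X) =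
    pushforward (@lebesgue_measure R)
      ((fun x => x + a) : _ -> measurableTypeR R) X by [].
rewrite shiftE; apply/esym/lebesgue_measure_unique => //=.
  exact: measurable_shift.
move=> mf _ [[b c]] _ <-; rewrite /pushforward.
have -> : (fun x : R => x + a) @^-1` `]b, c] = `]b - a, c - a]%classic.
  by apply/seteqP; split => x; rewrite /= !in_itv /= ltrBlDr lerBrDr.
rewrite !lebesgue_measure_itv /= !lte_fin ltrD2r.
by case: ifP => // _; rewrite -!EFinB opprB addrA subrK.
Qed.

Lemma ae_shift (R : realType) (a : R) (P : R -> Prop) :
  {ae @lebesgue_measure R, forall x : R, P x} ->
  {ae @lebesgue_measure R, forall x : R, P (x + a)}.
Proof.
move=> [A [mA A0 PA]]; exists ((fun x : R => x + a) @^-1` A); split.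
- by rewrite -[X in measurable X]setTI; exact: measurable_shift.
- by rewrite lebesgue_measure_shift.
- by move=> x Px; apply: PA.
Qed.

(** The real line has positive measure, so the almost-everywhere filter is proper. *)
Lemma ae_lebesgue_ex (R : realType) (P : R -> Prop) :
  {ae @lebesgue_measure R, forall x : R, P x} -> exists x, P x.
Proof.
move=> aeP.
have mu_gt0 : (0 < @lebesgue_measure R setT)%E.
  by rewrite -set_itvNyy lebesgue_measure_itv /= addye // ltry.
have pf := ae_properfilter_algebraOfSetsType mu_gt0.
exact: (@filter_ex _ _ pf P aeP).
Qed.

(** Euclidean division by [n]: each [l < N * n] is uniquely [k * n + i] with [i < n], and then
    [Negz l] lies in the residue class of [n - 1 - i]. *)
Lemma sum_residues (V : zmodType) (u : int -> V) (n N : nat) :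
  \sum_(0 <= i < n) \sum_(0 <= k < N)
      (u (i%:Z + Posz k * n%:Z) + u (i%:Z + Negz k * n%:Z)) =
  \sum_(0 <= l < N * n) (u (Posz l) + u (Negz l)).
Proof.
rewrite big_nat_mul exchange_big /=; apply: eq_bigr => k _.
rewrite -{1}[(k * n)%N]add0n big_addn mulSn addnK.
(* The sums over nonnegative indices agree by computation; only those over negative indices
   remain. *)
rewrite !big_split /=; congr (_ + _).
(* i + (- k - 1) n = - (k n + (n - 1 - i)) - 1 *)
rewrite big_nat_rev /= add0n !big_mkord; apply: eq_bigr => i _.
congr u; rewrite !NegzE.
have := ltn_ord i; lia.
Qed.

(** Each of the [n] residue classes contributes [p], and a finite sum passes to the limit. *)
Lemma cvg_sum_residues (R : realType) (u : int -> R[i]) (n : nat) (p : R[i]) :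
  (forall i : nat, zseries_cvg (fun k => u (i%:Z + k * n%:Z)) p) ->
  (fun N => series (fun l : nat => (u (Posz l) + u (Negz l) : R[i]^o)) (N * n)%N)
    @ \oo --> (p *+ n : R[i]^o).
Proof.
move=> up.
rewrite -[n in p *+ n]subn0 -sumr_const_nat.
under eq_fun do rewrite /series /= -sum_residues.
apply: (@cvg_big R[i]^o _ +%R 0 xpredT) => //; first exact: add_continuous.
by move=> i _; exact: up.
Qed.

Theorem theorem2p8 (R : realType) (n m : nat) (p q : R[i]) (f : R -> R[i])
  (n_gt0 : (0 < n)%N) (m_gt0 : (0 < m)%N)
  (f_meas : lebesgue_measurableC f)
  (absn : {ae @lebesgue_measure R, forall x : R,
     zseries_abs_cvg (fun k : int => f (x - k%:~R * n%:R))})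
  (absm : {ae @lebesgue_measure R, forall x : R,
     zseries_abs_cvg (fun k : int => f (x - k%:~R * m%:R))})
  (sumn : {ae @lebesgue_measure R, forall x : R,
     zseries_cvg (fun k : int => f (x - k%:~R * n%:R)) p})
  (summ : {ae @lebesgue_measure R, forall x : R,
     zseries_cvg (fun k : int => f (x - k%:~R * m%:R)) q}) :
  proportional (p, q) (m%:R, n%:R).
Proof.
pose sumsto (d : nat) (s : R[i]) (x : R) := forall i : nat,
  zseries_cvg (fun k : int => f (x - i%:R - k%:~R * d%:R)) s.
have ae_sumsto d s : {ae @lebesgue_measure R, forall x : R,
      zseries_cvg (fun k : int => f (x - k%:~R * d%:R)) s} ->
    {ae @lebesgue_measure R, forall x : R, sumsto d s x}.
  (* Countably many translates of a conull set still meet in a conull set. *)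
  by move=> sumd; apply: ae_foralln => i; exact: (ae_shift _ (- i%:R) _ sumd).
have [x [xn xm]] : exists x, (sumsto n p `&` sumsto m q) x.
  apply: ae_lebesgue_ex; apply: filterI; [|exact: ae_sumsto|exact: ae_sumsto].
  exact: (@ae_filter_ringOfSetsType _ _ _ (@lebesgue_measure R)).
(* From here on only the values of [f] on the coset of the integers through [x] matter. *)
pose u (j : int) := f (x - j%:~R).
have shiftE (i d : nat) (k : int) :
    f (x - i%:R - k%:~R * d%:R) = u (i%:Z + k * d%:Z).
  by rewrite /u intrD intrM opprD addrA !pmulrn.
have un : forall i : nat, zseries_cvg (fun k => u (i%:Z + k * n%:Z)) p.
  by move=> i; have := xn i; under eq_fun do rewrite shiftE.
have um : forall i : nat, zseries_cvg (fun k => u (i%:Z + k * m%:Z)) q.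
  by move=> i; have := xm i; under eq_fun do rewrite shiftE.
have pq : p *+ n = q *+ m.
  (* Passing to the subsequences of indices [N * m] and [N * n] makes both symmetric partial sums
     run up to [N * n * m]. *)
  have cn := cvg_comp _ _ (cvg_mulnr _ m_gt0) (cvg_sum_residues _ _ _ _ un).
  have cm := cvg_comp _ _ (cvg_mulnr _ n_gt0) (cvg_sum_residues _ _ _ _ um).
  apply: (@cvg_unique R[i]^o (@norm_hausdorff _ _) _ _ _ _ cn).
  suff -> : (fun N => series (fun l => u (Posz l) + u (Negz l) : R[i]^o) (N * n)%N)
      \o muln^~ m =
    (fun N => series (fun l => u (Posz l) + u (Negz l) : R[i]^o) (N * m)%N)
      \o muln^~ n by [].
  by apply/funext => N /=; rewrite mulnAC.
have m0 : m%:R != 0 :> R[i] by rewrite pnatr_eq0 -lt0n.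
(* The first coordinate forces this scalar; the second is then [p * n / m = q] by [pq]. *)
exists (p / m%:R); congr pair.
  by rewrite -[RHS]/(p / m%:R * m%:R) divfK.
by rewrite -[RHS]/(p / m%:R * n%:R) mulrAC mulr_natr pq -[q *+ m]mulr_natr mulfK.
Qed.
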